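(* We have $c_0^\times \leq_B E^H_{\mathrm{Diff}([0,1])}$.
   Context: $\mathcal{H}^+([0,1])$ is the group of increasing homeomorphisms of $[0,1]$ onto itself. $\mathrm{Diff}([0,1]) = \{f \in \mathcal{H}^+([0,1]) : f' \in \mathcal{C}([0,1]),\ (f^{-1})' \in \mathcal{C}([0,1])\}$ (one-sided derivatives at the endpoints). $\mathcal{F}([0,1])$ is the space of closed subsets of $[0,1]$ with the Vietoris topology, and $E^H_{\mathrm{Diff}([0,1])}$ is the equivalence relation on $\mathcal{F}([0,1])$ given by: $F_1\, E^H_{\mathrm{Diff}([0,1])}\, F_2$ iff there is $g \in \mathrm{Diff}([0,1])$ with $g(F_1) = F_2$. $c_0^\times$ is the equivalence relation on $(0,1)^{\mathbb{N}}$ given by $(x_n)\, c_0^\times\, (y_n)$ iff $\lim_{n\to\infty} x_n/y_n = 1$. For equivalence relations $E, F$ on standard Borel spaces $X, Y$: $E \leq_B F$ means there is a Borel map $f: X \to Y$ with $x E y \iff f(x) F f(y)$ for all $x,y\in X$. *)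

(* Defs.v *)
From HB Require Import structures.
From mathcomp Require Import all_boot all_order all_algebra.
From mathcomp Require Import all_classical all_reals all_analysis.

Set Implicit Arguments.
Unset Strict Implicit.
Unset Printing Implicit Defensive.

Import Order.TTheory GRing.Theory Num.Theory.
Import numFieldNormedType.Exports.

Local Open Scope classical_set_scope.
Local Open Scope ring_scope.

(* Borel sets are not taken through [measurableType], because the latter
   requires a distinguished point. *)
Definition borel_set (X : topologicalType) (B : set X) : Prop :=
  <<s @open X >> B.

Definition borel_map (X Y : topologicalType) (f : X -> Y) : Prop :=
  forall B : set Y, borel_set B -> borel_set (f @^-1` B).

Definition borel_reducible (X Y : topologicalType)
    (E : X -> X -> Prop) (F : Y -> Y -> Prop) : Prop :=
  exists f : X -> Y, borel_map f /\ forall x y : X, E x y <-> F (f x) (f y).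

(* The space of all closed subsets of X, the empty set included. *)
Definition hyperspace (X : topologicalType) : Type :=
  set_type [set A : set X | closed A].

Section Vietoris.
Variable X : topologicalType.

Definition vietoris_hit (U : set X) : set (hyperspace X) :=
  [set F | set_val F `&` U !=set0].

Definition vietoris_inside (U : set X) : set (hyperspace X) :=
  [set F | set_val F `<=` U].

Definition vietoris_subbase : set (set (hyperspace X)) :=
  [set vietoris_hit U | U in open] `|` [set vietoris_inside U | U in open].

HB.instance Definition _ := Choice.on (hyperspace X).
HB.instance Definition _ :=
  isSubBaseTopological.Build (hyperspace X) vietoris_subbase id.

End Vietoris.

Section UnitInterval.
Variable R : realType.

Definition I01 : topologicalType := set_type (`[0, 1] : set R).

Definition increasing_homeo (f g : I01 -> I01) : Prop :=
  [/\ forall x y : I01, set_val x < set_val y -> set_val (f x) < set_val (f y),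
      cancel f g, cancel g f, continuous f & continuous g].

(* The deleted neighbourhoods [x^'] are those of the space [0, 1], so the limit
   is one-sided when x is an endpoint. *)
Definition has_derivative (f : I01 -> I01) (x : I01) (l : R) : Prop :=
  (set_val (f y) - set_val (f x)) / (set_val y - set_val x) @[y --> x^'] --> l.

Definition continuously_differentiable (f : I01 -> I01) : Prop :=
  exists f' : I01 -> R,
    (forall x : I01, has_derivative f x (f' x)) /\ continuous f'.

Definition Diff01 (f : I01 -> I01) : Prop :=
  exists g : I01 -> I01,
    [/\ increasing_homeo f g, continuously_differentiable f
      & continuously_differentiable g].

Definition EH_Diff01 (F1 F2 : hyperspace I01) : Prop :=
  exists2 g : I01 -> I01, Diff01 g & g @` set_val F1 = set_val F2.

Definition open_unit_seq : topologicalType :=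
  {ptws nat -> set_type (`]0, 1[ : set R)}.

Definition c0_times (x y : open_unit_seq) : Prop :=
  set_val (x n) / set_val (y n) @[n --> \oo] --> (1 : R).

End UnitInterval.

(* Main.v *)
Require Import Defs.
From mathcomp Require Import all_boot all_order all_algebra.
From mathcomp Require Import all_classical all_reals all_analysis.
From mathcomp Require Import ring lra zify.

(**
The relation is first reduced to a relation between bounded sequences. For
[x] in [(0, 1)^N] the numbers [u_(k,j) = min (1, 2^j x_k)] determine [x], and
[x_k / y_k] tends to 1 if and only if [u_(k,j)(x) - u_(k,j)(y)] tends to 0 along
an enumeration of the pairs [(k, j)]: a small enough difference at the index [j]
that brings [2^j y_k] into [[1/4, 1/2)] bounds the relative error of [x_k], while
for a fixed [k] the two truncations are both 1 once [j] is large.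

A sequence [u_n] in [[0, 1]] is coded by the closed set consisting of 0 and the
points [q_n(u) = 2^-(n+1) (3/2 + u_n/32)], one in each dyadic interval
[(2^-(n+1), 2^-n)]. If [u_n - v_n] tends to 0, then the identity plus small dilated
copies of one fixed C^1 bump, supported in these disjoint intervals, is a
diffeomorphism that maps [q_n(u)] to [q_n(v)]. Conversely, an increasing
homeomorphism between two such sets fixes 0 and, by the order, must map [q_n(u)] to
[q_n(v)]; its derivative at 0 is the limit of [q_n(v) / q_n(u)], and this limit is 1
because [u_n = v_n] for infinitely many [n].
*)

Set Implicit Arguments.
Unset Strict Implicit.
Unset Printing Implicit Defensive.

Import Order.TTheory GRing.Theory Num.Theory.
Import numFieldNormedType.Exports.

Local Open Scope classical_set_scope.
Local Open Scope ring_scope.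

(** * Restricting diffeomorphisms of the line to the unit interval *)

Section Restriction.
Variable R : realType.
Implicit Types (G D : R -> R) (f : I01 R -> I01 R).

Lemma I01_itv (x : I01 R) : set_val x \in `[(0 : R), 1].
Proof. by have := set_valP x. Qed.

Lemma set_val_I01_continuous : continuous (fun x : I01 R => set_val x : R).
Proof. exact: initial_continuous. Qed.

Lemma I01_restrict G : {homo G : t / t \in `[(0 : R), 1]} ->
  exists f, forall x, set_val (f x) = G (set_val x).
Proof.
move=> G01.
have h (x : I01 R) : G (set_val x) \in (`[0, 1] : set R)%classic.
  by apply/mem_set; exact: G01 (I01_itv x).
by exists (fun x => exist (fun t => t \in (`[0, 1] : set R)%classic) _ (h x)).
Qed.

Lemma restrict_continuous G f : (forall x, set_val (f x) = G (set_val x)) ->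
  continuous G -> continuous f.
Proof.
move=> fG Gc; apply: continuous_comp_initial => x.
rewrite (_ : _ \o f = G \o set_val); last by apply/funext => y; exact: fG.
by apply: continuous_comp; [exact: set_val_I01_continuous | exact: Gc].
Qed.

(** The Caratheodory slope of [G] is continuous at [x] with value [l], and at every other point of
    the interval it is the difference quotient of [f]; this treats endpoints and interior points
    alike. *)
Lemma restrict_has_derivative G f (x : I01 R) (l : R) :
  (forall y, set_val (f y) = G (set_val y)) ->
  is_derive (set_val x : R) 1 G l -> has_derivative f x l.
Proof.
move=> fG /is_derive1_caratheodory[g [gE gc <-]].
apply: (@cvg_trans _ (g (set_val y) @[y --> x^'])).
  apply: near_eq_cvg; rewrite near_withinE; apply: nearW => y /eqP yx.
  rewrite !fG gE mulfK// subr_eq0; apply/eqP => yxE; apply: yx.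
  exact: val_inj.
have gvc : {for x, continuous (fun y : I01 R => g (set_val y))}.
  by apply: continuous_comp => //; exact: set_val_I01_continuous.
by apply: cvg_trans gvc; apply: cvg_app; exact: nbhs_dnbhs.
Qed.

Lemma restrict_continuously_differentiable G D f :
  (forall y, set_val (f y) = G (set_val y)) ->
  (forall t : R, t \in `[0, 1] -> is_derive t 1 G (D t)) ->
  {in `[(0 : R), 1], continuous D} -> continuously_differentiable f.
Proof.
move=> fG GD Dc; exists (D \o set_val); split=> x.
  by apply: restrict_has_derivative fG _; exact: GD (I01_itv x).
apply: continuous_comp; first exact: set_val_I01_continuous.
exact: Dc (I01_itv x).
Qed.

(** A positive derivative makes [G] strictly increasing by the mean value theorem, the fixed points
    0 and 1 and the intermediate value theorem make it map [[0, 1]] onto itself, and the inverse [H]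
    has the continuous derivative [1 / D (H t)]. *)
Lemma Diff01_restrict G D : (forall t : R, is_derive t 1 G (D t)) ->
  continuous D -> (forall t, 0 < D t) -> G 0 = 0 -> G 1 = 1 ->
  exists2 f, Diff01 f & forall x, set_val (f x) = G (set_val x).
Proof.
move=> GD Dc D0 G0 G1.
have Gc : continuous G.
  by move=> t; apply: differentiable_continuous; apply/derivable1_diffP; case: (GD t).
have Gi : {homo G : s t / s < t}.
  move=> s t st; have [|c _] := @MVT _ G D s t st (fun t _ => GD t).
    exact: continuous_subspaceT.
  by rewrite -subr_gt0 => ->; rewrite mulr_gt0// subr_gt0.
have Gle : {mono G : s t / s <= t} by exact: le_mono.
have G01 : {homo G : t / t \in `[(0 : R), 1]}.
  move=> t; rewrite !in_itv/= => /andP[? ?].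
  by rewrite -[leLHS]G0 -[X in _ && (_ <= X)]G1 !Gle; apply/andP.
have Gsurj t : t \in `[(0 : R), 1] -> exists2 s, s \in `[(0 : R), 1] & G s = t.
  rewrite in_itv/= => t01; apply: IVT => //; first exact: continuous_subspaceT.
  by rewrite G0 G1 (min_idPl _)// (max_idPr _).
(* [H] inverts [G] on its range, which contains [[0, 1]]; elsewhere it takes the default value 0. *)
pose H (t : R) : R := xget 0 [set s | G s = t].
have GH : cancel G H.
  move=> t; rewrite /H; case: xgetP => [s _ /= /(inc_inj Gle)//|/(_ t)] /=.
  by move=> /(_ erefl).
have H01 : {homo H : t / t \in `[(0 : R), 1]}.
  by move=> t /Gsurj[s s01 <-]; rewrite GH.
have HG t : t \in `[(0 : R), 1] -> G (H t) = t by move=> /Gsurj[s _ <-]; rewrite GH.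
have [f fE] := I01_restrict G01; have [g gE] := I01_restrict H01.
have Hder (t : R) : t \in `[0, 1] -> is_derive t 1 H (D (H t))^-1.
  (* [G] is differentiable on the whole line, so the inverse function theorem applies at 0 and 1 as
     well. *)
  move=> t01; rewrite -{1}(HG _ t01); apply: (@is_derive_inverse _ G H _ (H t)).
  - exact: filterE GH.
  - exact: filterE Gc.
  - by rewrite gt_eqF.
have Hc : {in `[(0 : R), 1], continuous H}.
  move=> t /Hder[? _]; apply: differentiable_continuous.
  exact/derivable1_diffP.
exists f => //; exists g; split.
- split.
  + by move=> x y; rewrite !fE; exact: Gi.
  + by move=> x; apply: val_inj => /=; rewrite -!set_valE gE fE GH.
  + by move=> x; apply: val_inj => /=; rewrite -!set_valE fE gE HG// I01_itv.
  + exact: restrict_continuous fE Gc.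
  + apply: continuous_comp_initial => x.
    rewrite (_ : _ \o g = H \o set_val); last by apply/funext => y; exact: gE.
    by apply: continuous_comp; [exact: set_val_I01_continuous|exact: Hc (I01_itv x)].
- by apply: restrict_continuously_differentiable fE _ _ => // t _; exact: Dc.
- apply: restrict_continuously_differentiable gE Hder _ => t t01.
  apply: cvgV; first by rewrite gt_eqF.
  by apply: continuous_comp; [exact: Hc|exact: Dc].
Qed.
End Restriction.

(** * Sums of functions supported in disjoint dyadic intervals *)

Section DyadicSum.
Variable R : realType.
Implicit Types (c : nat -> R -> R) (t s : R).

Definition dyadic_supported c :=
  forall n t, ~~ (2 ^- n.+1 < t < 2 ^- n) -> c n t = 0.

(* The terms of index [n] with [2 ^- n <= t] vanish at [t], so the truncated sum
   is the whole series; for [t <= 0] every term vanishes. *)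
Definition dyadic_sum c t : R := \sum_(n < (Num.trunc t^-1).+1) c n t.

Lemma exp2N_gt0 n : 0 < 2 ^- n :> R.
Proof. by rewrite invr_gt0 exprn_gt0. Qed.

Lemma exp2NS n : 2 ^- n = 2 * 2 ^- n.+1 :> R.
Proof. by rewrite exprS invfM mulrA divff ?mul1r// pnatr_eq0. Qed.

Lemma exp2N_le m n : (m <= n)%N -> 2 ^- n <= 2 ^- m :> R.
Proof. by move=> mn; rewrite lef_pV2 ?posrE ?exprn_gt0// ler_eXn2l// ltr1n. Qed.

Lemma exp2N_lt_ex t : 0 < t -> exists n, 2 ^- n < t.
Proof.
move=> t0; exists (Num.trunc t^-1).+1; rewrite invf_plt ?posrE ?exprn_gt0//.
apply: lt_trans (truncnS_gt _) _.
by rewrite -natrX ltr_nat ltn_expl.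
Qed.

(** Terms of index at least [M] vanish at [t], so the two truncations agree with a common longer
    one. *)
Lemma dyadic_sum_trunc c M t : dyadic_supported c -> 2 ^- M <= t ->
  dyadic_sum c t = \sum_(n < M) c n t.
Proof.
move=> cs Mt; rewrite /dyadic_sum -!(big_mkord predT (c ^~ t)).
have c0 k n : 2 ^- k <= t -> (k <= n)%N -> c n t = 0.
  move=> kt kn; apply: cs; rewrite negb_and -!leNgt.
  by rewrite (le_trans _ kt) ?orbT// exp2N_le.
set N := _.+1.
have Nt : 2 ^- N <= t.
  rewrite invf_ple ?posrE ?exprn_gt0//; last exact: lt_le_trans (exp2N_gt0 _) Mt.
  by rewrite ltW// (lt_trans (truncnS_gt _))// -natrX ltr_nat ltn_expl.
have eqmax k : 2 ^- k <= t -> (k <= maxn M N)%N ->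
    \sum_(0 <= i < maxn M N) c i t = \sum_(0 <= i < k) c i t.
  move=> kt kM; rewrite (big_cat_nat (leq0n k) kM)//=.
  rewrite [X in _ + X]big_nat_cond [X in _ + X]big1 ?addr0//.
  by move=> i; rewrite andbT => /andP[ki _]; exact: c0 ki.
by rewrite -!eqmax// ?leq_maxl ?leq_maxr.
Qed.

Lemma dyadic_sum_block c n t : dyadic_supported c -> 2 ^- n.+1 < t < 2 ^- n ->
  dyadic_sum c t = c n t.
Proof.
move=> cs /andP[nt tn]; rewrite (dyadic_sum_trunc cs (ltW nt)).
rewrite big_ord_recr/= big1 ?add0r//.
move=> i _; apply: cs; rewrite negb_and -!leNgt (le_trans (ltW tn))//.
exact: exp2N_le (ltn_ord i).
Qed.

Lemma dyadic_sumP c t : dyadic_supported c ->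
  dyadic_sum c t = 0 \/
  exists2 n, 2 ^- n.+1 < t < 2 ^- n & dyadic_sum c t = c n t.
Proof.
move=> cs; have [[n nt]|H] := pselect (exists n, 2 ^- n.+1 < t < 2 ^- n).
  by right; exists n => //; exact: dyadic_sum_block.
left; rewrite /dyadic_sum big1// => i _; apply: cs; apply/negP => it.
by apply: H; exists i.
Qed.

Lemma dyadic_sum_le0 c t : dyadic_supported c -> t <= 0 -> dyadic_sum c t = 0.
Proof.
move=> cs t0; have [//|[n /andP[nt _] _]] := dyadic_sumP t cs.
by have := lt_le_trans nt t0; rewrite ltNge (ltW (exp2N_gt0 _)).
Qed.

(** Away from 0 the sum is locally finite. [M] is chosen before the family [c], so that a sum and
    the sum of the derivatives are truncated together. *)
Lemma dyadic_sum_near t : t != 0 -> exists M, \forall s \near t,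
  forall c, dyadic_supported c -> dyadic_sum c s = \sum_(n < M) c n s.
Proof.
rewrite neq_lt => /orP[t0|t0].
  exists 0; near=> s => c cs; rewrite big_ord0 dyadic_sum_le0//.
  by apply: ltW; near: s; exact: lt_nbhsl.
have [M Mt] := exp2N_lt_ex t0; exists M; near=> s => c cs.
by apply: dyadic_sum_trunc => //; apply: ltW; near: s; exact: lt_nbhsr.
Unshelve. all: by end_near. Qed.

(** Below [2 ^- N] only terms of index at least [N] can be nonzero, and at each point at most one
    is, so a uniform bound on single terms bounds the sum. *)
Lemma dyadic_sum_continuous0 c : dyadic_supported c ->
  (forall e : R, 0 < e -> \forall n \near \oo, forall t, `|c n t| <= e) ->
  {for 0, continuous (dyadic_sum c)}.
Proof.
move=> cs cu; apply/cvgrPdist_le => /= e e0; rewrite (dyadic_sum_le0 cs)//.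
have [N _ HN] := cu _ e0; near=> t; rewrite sub0r normrN.
have [->|[n /andP[nt _] ->]] := dyadic_sumP t cs; first by rewrite normr0 ltW.
apply: HN => /=; rewrite leqNgt; apply/negP => nN.
have := le_lt_trans (exp2N_le nN) nt; rewrite ltNge => /negP; apply.
by apply: ltW; near: t; apply: lt_nbhsl; exact: exp2N_gt0.
Unshelve. all: by end_near. Qed.

Lemma dyadic_sum_continuous c : dyadic_supported c ->
  (forall n, continuous (c n)) ->
  (forall e : R, 0 < e -> \forall n \near \oo, forall t, `|c n t| <= e) ->
  continuous (dyadic_sum c).
Proof.
move=> cs cc cu t; have [->|t0] := eqVneq t 0; first exact: dyadic_sum_continuous0.
have [M HM] := dyadic_sum_near t0.
have sc : continuous (fun s => \sum_(n < M) c n s).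
  by apply: continuous_big => [|i _]; [exact: add_continuous | exact: cc].
rewrite /continuous_at (nbhs_singleton HM)//.
apply: (@cvg_trans _ ((\sum_(n < M) c n s) @[s --> t])).
  by apply: near_eq_cvg; apply: filterS HM => s /(_ _ cs) ->.
exact: sc.
Qed.

(** At 0 the difference quotient is itself the dyadic sum of the terms [c n s / s], which tends to 0
    by the last hypothesis; elsewhere the sum is locally finite. *)
Lemma dyadic_sum_is_derive c c' t : dyadic_supported c -> dyadic_supported c' ->
  (forall n s, is_derive s 1 (c n) (c' n s)) ->
  (forall e : R, 0 < e -> \forall n \near \oo, forall s, `|c n s / s| <= e) ->
  is_derive t 1 (dyadic_sum c) (dyadic_sum c' t).
Proof.
move=> cs cs' cd cu; have [->|t0] := eqVneq t 0.
  rewrite dyadic_sum_le0//; apply/is_derive1_caratheodory.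
  pose d n s := c n s / s; have ds : dyadic_supported d.
    by move=> n s ns; rewrite /d cs// mul0r.
  exists (dyadic_sum d); split.
  - move=> z; rewrite [X in _ - X]dyadic_sum_le0// !subr0.
    have [->|z0] := eqVneq z 0; first by rewrite mulr0 dyadic_sum_le0.
    by rewrite /dyadic_sum mulr_suml; apply: eq_bigr => i _; rewrite mulfVK.
  - exact: dyadic_sum_continuous0.
  - exact: dyadic_sum_le0.
have [M HM] := dyadic_sum_near t0; rewrite (nbhs_singleton HM)//.
apply: (@near_eq_is_derive _ _ _ (\sum_(n < M) c n)).
  by apply: filterS HM => s /(_ _ cs) ->; rewrite fct_sumE.
Qed.
End DyadicSum.

(** * A C^1 bump supported in [1, 2] *)

Section Bump.
Variable R : realType.
Implicit Types (t s : R) (u v d : nat -> R).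

(** The square of the positive part of [(s - 1) * (2 - s)]; squaring removes the corners at 1 and 2,
    so that the bump is C^1. *)
Definition bump s : R := (s - 1) * (2 - s) * Num.max 0 ((s - 1) * (2 - s)).

Definition bump' s : R := 2 * Num.max 0 ((s - 1) * (2 - s)) * (3 - 2 * s).

Lemma bump0 s : ~~ (1 < s < 2) -> bump s = 0 /\ bump' s = 0.
Proof.
move=> s12; have s0 : (s - 1) * (2 - s) <= 0.
  by move: s12; rewrite negb_and -!leNgt => /orP[]; nra.
by rewrite /bump /bump' (max_idPl s0) !mulr0 mul0r.
Qed.

Lemma max0_continuous : continuous (fun z : R => Num.max 0 z).
Proof. by move=> z; apply: continuous_max; [exact: cst_continuous|exact: cvg_id]. Qed.

Lemma is_derive_mul_max0 (z : R) :
  is_derive z 1 (fun z : R => z * Num.max 0 z) (2 * Num.max 0 z).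
Proof.
have [z0|z0|<-] := ltgtP 0 z; last 1 first.
- apply/is_derive1_caratheodory; exists (fun z => Num.max 0 z).
  split; last by rewrite maxxx mulr0.
  + by move=> y; rewrite mul0r !subr0 mulrC.
  + exact: max0_continuous.
- apply: (@near_eq_is_derive _ _ _ (fun z : R => z * z)).
    near=> y; rewrite (max_idPr _)// ltW//; near: y; exact: lt_nbhsr.
  rewrite (_ : 2 * z = z *: 1 + z *: 1); last by rewrite /GRing.scale/=; ring.
  exact: is_deriveM.
- apply: (@near_eq_is_derive _ _ _ (cst 0)).
    near=> y; rewrite (max_idPl _) ?mulr0// ltW//; near: y; exact: lt_nbhsl.
  by rewrite mulr0; exact: is_derive_cst.
Unshelve. all: by end_near. Qed.

Lemma is_derive_bump s : is_derive s 1 bump (bump' s).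
Proof.
have h : is_derive s 1 (fun s : R => (s - 1) * (2 - s)) (3 - 2 * s).
  by apply: is_derive_eq; rewrite /GRing.scale/=; ring.
exact: (is_derive1_comp (is_derive_mul_max0 _) h).
Qed.

Lemma bump'_continuous : continuous bump'.
Proof.
move=> s; rewrite /bump'; apply: cvgM; last first.
  by apply: cvgB; [exact: cvg_cst|exact: mulrl_continuous].
apply: cvgM; first exact: cvg_cst.
apply: (@continuous_comp _ _ _ (fun s : R => (s - 1) * (2 - s)));
  last exact: max0_continuous.
by apply: cvgM; apply: cvgB; (exact: cvg_cst || exact: cvg_id).
Qed.

(** The upper bound comes from [(s - 1) (2 - s) = 1/4 - (s - 3/2)^2]. *)
Lemma bump_arg_itv s : 1 <= s -> s <= 2 ->
  0 <= (s - 1) * (2 - s) /\ (s - 1) * (2 - s) <= 4^-1.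
Proof. have := sqr_ge0 (s - 3 / 2); split; nra. Qed.

Lemma bump_div_le1 s : `|bump s / s| <= 1.
Proof.
have [/andP[s1 s2]|/bump0[-> _]] := boolP (1 < s < 2); last by rewrite mul0r normr0.
have s0 : 0 < s by lra.
have [z0 z4] := bump_arg_itv (ltW s1) (ltW s2).
rewrite /bump (max_idPr z0); move: z0 z4; set z := (s - 1) * (2 - s) => z0 z4.
rewrite normrM normfV (gtr0_norm s0) ler_pdivrMr// mul1r ger0_norm; nra.
Qed.

(** On [(1, 2)] one has [2 (s - 1) (2 - s) <= 1/2] and [|3 - 2 s| <= 1]. A bound below 1 keeps
    [1 + d * bump' s] positive for [|d| <= 1]. *)
Lemma bump'_le s : `|bump' s| <= 2^-1.
Proof.
have [/andP[s1 s2]|/bump0[_ ->]] := boolP (1 < s < 2); last by rewrite normr0 invr_ge0.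
have [z0 z4] := bump_arg_itv (ltW s1) (ltW s2).
rewrite /bump' (max_idPr z0); move: z0 z4; set z := (s - 1) * (2 - s) => z0 z4.
rewrite ler_norml; apply/andP; split; nra.
Qed.
End Bump.

(** * Diffeomorphisms moving one point in each dyadic interval *)

Section DyadicDiffeo.
Variable R : realType.
Implicit Types (t s : R) (u v d : nat -> R).

(** The factor [2 ^- n.+1] compensates the dilation: the derivative and the quotient by [t] are
    bounded by [|d n|] at every scale. *)
Definition dyadic_bump d n t : R := d n * (2 ^- n.+1 * bump (2 ^+ n.+1 * t)).

Definition dyadic_bump' d n t : R := d n * bump' (2 ^+ n.+1 * t).

Lemma dyadic_itv_scale n t : (1 < 2 ^+ n.+1 * t < 2) = (2 ^- n.+1 < t < 2 ^- n).
Proof.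
rewrite (exp2NS _ n) -(ltr_pdivrMl _ _ (exprn_gt0 n.+1 (ltr0Sn R 1))) mulr1.
by rewrite -(ltr_pdivlMl _ _ (exprn_gt0 n.+1 (ltr0Sn R 1))) [2 * _]mulrC.
Qed.

Lemma dyadic_bump_supported d : dyadic_supported (dyadic_bump d).
Proof.
by move=> n t; rewrite -dyadic_itv_scale /dyadic_bump => /bump0[-> _]; rewrite !mulr0.
Qed.

Lemma dyadic_bump'_supported d : dyadic_supported (dyadic_bump' d).
Proof.
by move=> n t; rewrite -dyadic_itv_scale /dyadic_bump' => /bump0[_ ->]; rewrite mulr0.
Qed.

Lemma is_derive_dyadic_bump d n t : is_derive t 1 (dyadic_bump d n) (dyadic_bump' d n t).
Proof.
have scale : is_derive t 1 (fun t : R => 2 ^+ n.+1 * t) (2 ^+ n.+1).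
  by apply: is_derive_eq; rewrite /GRing.scale/=; ring.
have h := is_derive1_comp (is_derive_bump (2 ^+ n.+1 * t)) scale.
apply: is_derive_eq; rewrite /dyadic_bump' /GRing.scale/=.
by congr (_ * _); rewrite mulrCA mulVf ?mulr1// expf_neq0// pnatr_eq0.
Qed.

Lemma dyadic_bump'_continuous d n : continuous (dyadic_bump' d n).
Proof.
move=> t; apply: cvgM; first exact: cvg_cst.
apply: (@continuous_comp _ _ _ (fun t => 2 ^+ n.+1 * t)); last exact: bump'_continuous.
exact: mulrl_continuous.
Qed.

Lemma dyadic_bump_div_le d n t : `|dyadic_bump d n t / t| <= `|d n|.
Proof.
rewrite /dyadic_bump -mulrA normrM ler_piMr//.
rewrite (_ : _ / t = bump (2 ^+ n.+1 * t) / (2 ^+ n.+1 * t)).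
  exact: bump_div_le1.
by rewrite invfM [RHS]mulrCA [RHS]mulrA.
Qed.

Lemma dyadic_bump'_le d n t : `|dyadic_bump' d n t| <= `|d n| / 2.
Proof. by rewrite normrM ler_wpM2l// bump'_le. Qed.

(** The bound [|d n| <= 1] keeps the derivative at least 1/2, and [d n -> 0] makes it exist and be
    continuous at 0, with value 1. *)
Lemma dyadic_bump_Diff01 d : (forall n, `|d n| <= 1) -> d n @[n --> \oo] --> 0 ->
  exists2 f, Diff01 f &
    forall x, set_val (f x) = set_val x + dyadic_sum (dyadic_bump d) (set_val x).
Proof.
move=> d1 d0.
have bs := dyadic_bump_supported d; have bs' := dyadic_bump'_supported d.
have dle (e : R) : 0 < e -> \forall n \near \oo, `|d n| <= e.
  by move=> e0; move/cvgr0_norm_le: d0; exact.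
apply: (@Diff01_restrict R (fun t => t + dyadic_sum (dyadic_bump d) t)
  (fun t => 1 + dyadic_sum (dyadic_bump' d) t)).
- move=> t; have h := dyadic_sum_is_derive t bs bs' (is_derive_dyadic_bump d).
  apply: (is_deriveD (is_derive_id _ _) (h _)) => e /dle.
  by apply: filterS => n + s; exact/le_trans/dyadic_bump_div_le.
- move=> t; apply: cvgD; first exact: cvg_cst.
  apply: dyadic_sum_continuous => // [|e /dle]; first exact: dyadic_bump'_continuous.
  apply: filterS => n + s; apply/le_trans/(le_trans (dyadic_bump'_le _ _ _)).
  by rewrite ler_pdivrMr// ler_peMr// ler1n.
- move=> t; have [->|[n _ ->]] := dyadic_sumP t bs'; first by rewrite addr0.
  have := dyadic_bump'_le d n t; rewrite ler_norml => /andP[+ _]; have := d1 n; lra.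
- by rewrite dyadic_sum_le0// addr0.
- by rewrite (@dyadic_sum_trunc _ _ 0 1)// ?big_ord0 ?addr0// expr0 invr1.
Qed.

(** In the coordinate [s = 2 ^+ n.+1 * t] this is [3/2 + u n / 32], which for [u n] in [[0, 1]]
    stays close to the maximum of [bump] at 3/2. *)
Definition dyadic_pt u n : R := 2 ^- n.+1 * (3 / 2 + u n / 32).

Lemma dyadic_pt_itv u n : 0 <= u n <= 1 -> 2 ^- n.+1 < dyadic_pt u n < 2 ^- n.
Proof.
move=> u01; rewrite (exp2NS R n) /dyadic_pt mulrC [2 * _]mulrC.
have := exp2N_gt0 R n.+1; set e := 2 ^- _ => e0; nra.
Qed.

Lemma dyadic_pt_Diff01 u v : (forall n, 0 <= u n <= 1) -> (forall n, 0 <= v n <= 1) ->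
  v n - u n @[n --> \oo] --> 0 ->
  exists2 f : I01 R -> I01 R, Diff01 f &
    (forall x, set_val x = 0 -> set_val (f x) = 0) /\
    (forall n x, set_val x = dyadic_pt u n -> set_val (f x) = dyadic_pt v n).
Proof.
move=> u01 v01 uv.
(* In the coordinate [s], [d n] is the required displacement [(v n - u n) / 32] divided by the
   height of the bump at the point to be moved. *)
pose b n := bump (3 / 2 + u n / 32); pose d n := (v n - u n) / 32 / b n.
have b_ge n : 25^-1 <= b n.
  rewrite /b /bump; set z := (_ - 1) * (2 - _); have z5 : 5^-1 <= z.
    by rewrite /z; have /andP[] := u01 n; move: (u n) => w w0 w1; nra.
  by rewrite (max_idPr _); nra.
have b_gt n : 0 < b n by have := b_ge n; lra.
(* The denominator 32 exceeds [1 / b n <= 25]; this gives both [|d n| <= 1] and [d n -> 0]. *)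
have dle n : `|d n| <= `|v n - u n|.
  rewrite /d normrM normfV (gtr0_norm (b_gt n)) ler_pdivrMr// normrM.
  have := b_ge n; have := normr_ge0 (v n - u n); rewrite (@gtr0_norm _ 32^-1)//; nra.
have d1 n : `|d n| <= 1.
  apply: le_trans (dle n) _; rewrite ler_norml; have := u01 n; have := v01 n; lra.
have d0 : d n @[n --> \oo] --> 0.
  apply/norm_cvg0P; apply: (@squeeze_cvgr _ _ _ _ (cst 0) (fun n => `|v n - u n|)).
  - by apply: nearW => n; rewrite normr_ge0 dle.
  - exact: cvg_cst.
  - exact/norm_cvg0P.
have [f fD fE] := dyadic_bump_Diff01 d1 d0; exists f => //; split.
  by move=> x x0; rewrite fE x0 dyadic_sum_le0 ?addr0//; exact: dyadic_bump_supported.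
move=> n x xu; rewrite fE xu.
rewrite (dyadic_sum_block (@dyadic_bump_supported d) (dyadic_pt_itv (u01 n))).
rewrite /dyadic_bump /dyadic_pt mulVKf ?expf_neq0 ?pnatr_eq0//.
rewrite -/(b n) /d mulrCA -mulrDr divfK ?gt_eqF//.
by congr (_ * _); ring.
Qed.
End DyadicDiffeo.

(** * Truncated dyadic coordinates *)

Section Coding.

(* The enumeration of pairs given by [n + 1 = 2 ^ pair_row n * (2 * pair_col n + 1)]. *)
Definition pair_row n := logn 2 n.+1.

Definition pair_col n := (n.+1 %/ 2 ^ pair_row n)./2.

(** The bounds on [k] and [j] place the index [n] in any prescribed tail once the row or the column
    is large. *)
Lemma pair_surj k j :
  exists n, [/\ (k <= n)%N, (j <= n)%N, pair_row n = k & pair_col n = j].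
Proof.
exists (2 ^ k * j.*2.+1).-1.
have k0 : (0 < 2 ^ k)%N by rewrite expn_gt0.
have S : (2 ^ k * j.*2.+1).-1.+1 = (2 ^ k * j.*2.+1)%N by rewrite prednK// muln_gt0 k0.
have rowE : pair_row (2 ^ k * j.*2.+1).-1 = k.
  rewrite /pair_row S lognM// pfactorK// logn_coprime ?addn0//.
  by rewrite coprime2n/= odd_double.
split => //.
- by rewrite -ltnS S (leq_trans (ltn_expl k (ltnSn 1)))// leq_pmulr.
- by rewrite -ltnS S (leq_trans _ (leq_pmull _ k0))// ltnS -addnn leq_addr.
- by rewrite /pair_col rowE S mulKn// -[_.+1]/(true + _)%N half_bit_double.
Qed.

(** Only finitely many indices have both coordinates bounded: the power of 2 in [n + 1] is at most
    [2 ^ K] and its odd part at most [2 J]. *)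
Lemma pair_bound n K J : (pair_row n < K)%N -> (pair_col n < J)%N -> (n < 2 ^ K * J.*2)%N.
Proof.
move=> nK nJ; rewrite -[n.+1](divnK (pfactor_dvdnn 2 n.+1)) mulnC -/(pair_row n).
rewrite leq_mul ?leq_exp2l ?(ltnW nK)//.
by rewrite -(odd_double_half (_ %/ _)) -/(pair_col n); case: odd => /=; lia.
Qed.

Variable R : realType.
Implicit Types (a b e : R) (x y : nat -> R).

(** For [b <= 1] the left side is at most [|a - b| = b |a / b - 1|]; for [b > 1] it is nonzero only
    if [a < 1], and then [a >= a / b]. The right side is invariant under scaling, so the bound is
    uniform over the factors [2 ^+ j]. *)
Lemma min1_dist a b : 0 < a -> 0 < b ->
  `|Num.min 1 a - Num.min 1 b| <= `|a / b - 1|.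
Proof.
move=> a0 b0; set r := a / b; have ab : a = r * b by rewrite /r divfK// gt_eqF.
have r0 : 0 < r by rewrite divr_gt0.
clearbody r; subst a.
have [r1|r1] := lerP 0 (r - 1); rewrite ler_norml ?(ger0_norm r1) ?(ltr0_norm r1);
  have [b1|b1] := lerP 1 b; have [a1|a1] := lerP 1 (r * b); apply/andP; split; nra.
Qed.

(** At the least [j] with [2^j b >= 1/4] neither minimum is attained by 1: either [j = 0], or
    [2^j b < 1/2] and [e < 1/4] forces [2^j a < 1]. Dividing by [2^j b] then costs a factor of at
    most 4. *)
Lemma min1_dist_inv e a b : e < 4^-1 -> 0 < a < 1 -> 0 < b < 1 ->
  (forall j, `|Num.min 1 (2 ^+ j * a) - Num.min 1 (2 ^+ j * b)| <= e) ->
  `|a / b - 1| <= 4 * e.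
Proof.
move=> e4 /andP[a0 a1] /andP[b0 b1] H.
have [j j4 j1] : exists2 j, 4^-1 <= 2 ^+ j * b & 2 ^+ j * b < 2^-1 \/ j = 0%N.
  have P : exists j, 4^-1 <= 2 ^+ j * b.
    have [j jb] := exp2N_lt_ex b0; exists j; apply: (@le_trans _ _ 1); first by lra.
    by rewrite -(@ler_pdivrMl _ (2 ^+ j)) ?exprn_gt0// mulr1 ltW.
  have [[|j] jb jmin] := ex_minnP P; first by exists 0%N; [|right].
  exists j.+1 => //; left; rewrite exprS -mulrA.
  have : 2 ^+ j * b < 4^-1 by rewrite ltNge; apply/negP => /jmin; rewrite ltnn.
  by lra.
have r0 : 0 < 2 ^+ j :> R by rewrite exprn_gt0.
have {H} := H j; have -> : a / b = 2 ^+ j * a / (2 ^+ j * b).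
  by rewrite -mulf_div divff ?mul1r// gt_eqF.
have A1 : 2 ^+ j * b < 2^-1 \/ 2 ^+ j * a < 1.
  by case: j1 => [|->]; [left|right; rewrite mul1r].
have b1' : 2 ^+ j * b < 1 by case: j1 => [|->]; [lra|rewrite mul1r].
move: (2 ^+ j * a) (2 ^+ j * b) j4 A1 b1' => A B j4 A1 b1'.
rewrite (min_idPr (ltW b1')) => ab.
have {A1} a1' : A < 1.
  by case: A1 => // b2; move: ab; have [] := lerP 1 A => //; rewrite ler_norml; lra.
rewrite (min_idPr (ltW a1')) in ab.
have -> : A / B - 1 = (A - B) / B by field; rewrite gt_eqF//; lra.
rewrite normrM normfV ler_pdivrMr ?normr_gt0 ?gt_eqF//; last by lra.
rewrite (gtr0_norm (_ : 0 < B)); last by lra.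
by have := normr_ge0 (A - B); nra.
Qed.

Definition dyadic_trunc x n : R := Num.min 1 (2 ^+ pair_col n * x (pair_row n)).

Lemma dyadic_trunc_itv x n : (forall k, 0 < x k) -> 0 <= dyadic_trunc x n <= 1.
Proof. by move=> x0; rewrite /dyadic_trunc le_min ler01 ge_min lexx/= mulr_ge0// ltW. Qed.

Lemma dyadic_trunc_eq1 x n K : 2 ^- K < x (pair_row n) -> (K <= pair_col n)%N ->
  dyadic_trunc x n = 1.
Proof.
move=> xK Kn; apply/min_idPl; rewrite -ler_pdivrMl ?exprn_gt0// mulr1.
by rewrite ltW// (le_lt_trans _ xK)// exp2N_le.
Qed.

(** Rows from [K] on are controlled by the quotients, uniformly in the column; in the finitely many
    earlier rows both truncations are 1 from column [J] on; only finitely many pairs remain. *)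
Lemma cvg_dyadic_trunc x y : (forall k, 0 < x k) -> (forall k, 0 < y k) ->
  x k / y k @[k --> \oo] --> (1 : R) ->
  dyadic_trunc x n - dyadic_trunc y n @[n --> \oo] --> (0 : R).
Proof.
move=> x0 y0 xy; apply/cvgrPdist_le => /= e e0.
have [K _ HK] := cvgr_dist_le _ _ xy _ e0.
have [Jx HJx] := choice (fun k => exp2N_lt_ex (x0 k)).
have [Jy HJy] := choice (fun k => exp2N_lt_ex (y0 k)).
pose J := \max_(k < K) maxn (Jx k) (Jy k).
near=> n; rewrite sub0r normrN.
have [Kn|nK] := leqP K (pair_row n).
  apply: le_trans (min1_dist _ _) _; rewrite ?mulr_gt0 ?exprn_gt0//.
  rewrite -mulf_div divff ?mul1r ?expf_neq0 ?pnatr_eq0// distrC.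
  exact: HK.
have Jn : (J <= pair_col n)%N.
  rewrite leqNgt; apply/negP => /(pair_bound nK); apply/negP; rewrite -leqNgt.
  by near: n; exists (2 ^ K * J.*2)%N.
have : (maxn (Jx (pair_row n)) (Jy (pair_row n)) <= J)%N.
  exact: (leq_bigmax (F := fun k : 'I_K => maxn (Jx k) (Jy k)) (Ordinal nK)).
rewrite geq_max => /andP[xJ yJ].
rewrite (dyadic_trunc_eq1 (HJx _) (leq_trans xJ Jn)).
by rewrite (dyadic_trunc_eq1 (HJy _) (leq_trans yJ Jn)) subrr normr0 ltW.
Unshelve. all: by end_near. Qed.

Lemma dyadic_trunc_cvg x y : (forall k, 0 < x k < 1) -> (forall k, 0 < y k < 1) ->
  dyadic_trunc x n - dyadic_trunc y n @[n --> \oo] --> (0 : R) ->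
  x k / y k @[k --> \oo] --> (1 : R).
Proof.
move=> x01 y01 xy; apply/cvgrPdist_le => /= e e0.
(* [e / 4] absorbs the factor 4 of [min1_dist_inv], and 1/5 ensures its hypothesis [d < 1/4]. *)
pose d := Num.min (e / 4) 5^-1; have d0 : 0 < d by rewrite lt_min divr_gt0//= invr_gt0.
have [N _ HN] := cvgr_dist_le _ _ xy _ d0.
exists N => // k /= Nk; rewrite distrC; apply: (@le_trans _ _ (4 * d)); last first.
  by rewrite mulrC -ler_pdivlMr// ge_min lexx.
apply: min1_dist_inv => // [|j].
  by rewrite (@le_lt_trans _ _ 5^-1)// ?ge_min ?lexx ?orbT//; lra.
have [n [kn _ rn cn]] := pair_surj k j.
by have := HN n (leq_trans Nk kn); rewrite sub0r normrN /dyadic_trunc rn cn.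
Qed.

(** Both truncations are 1 far out in row 0. This identifies the derivative at 0 of a diffeomorphism
    between two codes. *)
Lemma frequently_dyadic_trunc_eq x y N : (forall k, 0 < x k) -> (forall k, 0 < y k) ->
  exists2 n, (N <= n)%N & dyadic_trunc x n = dyadic_trunc y n.
Proof.
move=> x0 y0; have [[Jx HJx] [Jy HJy]] := (exp2N_lt_ex (x0 0%N), exp2N_lt_ex (y0 0%N)).
have [n [_ Jn rn cn]] := pair_surj 0 (maxn (maxn Jx Jy) N).
exists n; first by rewrite (leq_trans _ Jn)// leq_maxr.
by rewrite (@dyadic_trunc_eq1 _ _ Jx) ?(@dyadic_trunc_eq1 _ _ Jy) ?rn// cn -maxnA
  ?leq_maxl// (maxnCA Jx) leq_maxl.
Qed.
End Coding.

(** * The coding of sequences by closed sets *)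

Lemma borel_map_continuous (X Y : topologicalType) (f : X -> Y) :
  (forall A, open A -> open (f @^-1` A)) -> borel_map f.
Proof.
move=> fo B; apply: (@smallest_sub _ _ _ [set B | borel_set (f @^-1` B)]).
  split.
  - rewrite /= preimage_set0; exact: sigma_algebra0.
  - move=> A /= fA; rewrite setTD preimage_setC -setTD; exact: sigma_algebraCD.
  - move=> A /= fA; rewrite preimage_bigcup; exact: sigma_algebra_bigcup.
by move=> A Ao; apply: sub_sigma_algebra; exact: fo.
Qed.

Lemma hyperspace_open_preimage (X Y : topologicalType) (f : X -> hyperspace Y) :
  (forall U, open U -> open [set x | set_val (f x) `&` U !=set0]) ->
  (forall U, open U -> open [set x | set_val (f x) `<=` U]) ->
  forall A, open A -> open (f @^-1` A).
Proof.
move=> hit inside A [D sD <-]; rewrite preimage_bigcup; apply: bigcup_open => B DB.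
have [E sE <-] := sD _ DB; rewrite preimage_bigcap.
rewrite openE => x xE; apply: filter_bigI => C CE.
apply: open_nbhs_nbhs; split; last exact: xE.
by have /set_mem[[U Uo <-]|[U Uo <-]] := sE _ CE; [exact: hit|exact: inside].
Qed.

(** Since [n <= s n], a preimage [m] of [n] satisfies [m <= n], and [m < n] would give [s m = m] by
    induction. *)
Lemma increasing_surj_nat_id (s : nat -> nat) :
  {homo s : m n / (m < n)%N} -> (forall n, exists m, s m = n) -> s =1 id.
Proof.
move=> si ss; have les n : (n <= s n)%N.
  by elim: n => // n IHn; exact: leq_ltn_trans IHn (si _ _ (ltnSn n)).
elim/ltn_ind => n IHn; have [m mn] := ss n.
have : (m <= n)%N by rewrite -mn.
rewrite leq_eqVlt => /predU1P[mE|mltn]; first by rewrite -{1}mE.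
by have := mltn; rewrite -{1}mn (IHn _ mltn) ltnn.
Qed.

Section Reduction.
Variable R : realType.
Implicit Types (x y : open_unit_seq R) (w : nat -> R).

Definition real_seq x (k : nat) : R := set_val (x k).

Lemma real_seq_itv x k : 0 < real_seq x k < 1.
Proof. by have := set_valP (x k); rewrite /= in_itv. Qed.

Lemma real_seq_gt0 x k : 0 < real_seq x k.
Proof. by case/andP: (real_seq_itv x k). Qed.

Lemma real_seq_continuous k : continuous (real_seq ^~ k).
Proof.
move=> x; apply: (@continuous_comp _ _ _ (fun x : open_unit_seq R => x k)).
  exact: (@proj_continuous nat (fun=> set_type (`]0, 1[%classic : set R)) k).
exact: initial_continuous.
Qed.

Definition trunc_seq x : nat -> R := dyadic_trunc (real_seq x).

Lemma trunc_seq_itv x n : 0 <= trunc_seq x n <= 1.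
Proof. by apply: dyadic_trunc_itv => k; exact: real_seq_gt0. Qed.

Lemma trunc_seq_continuous n : continuous (trunc_seq ^~ n).
Proof.
have c : continuous (fun t : R => Num.min 1 (2 ^+ pair_col n * t)).
  move=> t; apply: continuous_min; first exact: cst_continuous.
  exact: mulrl_continuous.
move=> x; exact: continuous_comp (@real_seq_continuous (pair_row n) x) (c _).
Qed.

Definition to_I01 (t : R) (t01 : t \in (`[0, 1] : set R)%classic) : I01 R :=
  exist (fun t => t \in (`[0, 1] : set R)%classic) t t01.

Lemma code_pt_subproof x n : dyadic_pt (trunc_seq x) n \in (`[0, 1] : set R)%classic.
Proof.
apply/mem_set; rewrite /= in_itv/=.
have /andP[lb ub] := dyadic_pt_itv (trunc_seq_itv x n).
rewrite (le_trans (ltW (exp2N_gt0 _ _)) (ltW lb)) (le_trans (ltW ub))//.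
by have := exp2N_le R (leq0n n); rewrite expr0 invr1.
Qed.

Definition code_pt x n : I01 R := to_I01 (code_pt_subproof x n).

Lemma zero_subproof : 0 \in (`[0, 1] : set R)%classic.
Proof. by apply/mem_set; rewrite /= in_itv/= lexx ler01. Qed.

Definition zero_I01 : I01 R := to_I01 zero_subproof.

Lemma code_ptE x n : set_val (code_pt x n) = dyadic_pt (trunc_seq x) n.
Proof. by []. Qed.

Lemma zero_I01E : set_val zero_I01 = 0 :> R. Proof. by []. Qed.

Lemma code_pt_gt0 x n : 0 < set_val (code_pt x n) :> R.
Proof.
rewrite code_ptE.
by have /andP[/(lt_trans (exp2N_gt0 _ _))] := dyadic_pt_itv (trunc_seq_itv x n).
Qed.

Lemma code_pt_decr x m n : (m < n)%N ->
  set_val (code_pt x n) < set_val (code_pt x m) :> R.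
Proof.
move=> mn; rewrite !code_ptE.
have /andP[_ ub] := dyadic_pt_itv (trunc_seq_itv x n).
have /andP[lb _] := dyadic_pt_itv (trunc_seq_itv x m).
by rewrite (lt_trans ub)// (le_lt_trans _ lb)// exp2N_le.
Qed.

Lemma code_pt_continuous n : continuous (code_pt ^~ n).
Proof.
have c : continuous (fun t : R => 2 ^- n.+1 * (3 / 2 + t / 32)).
  move=> t; apply: cvgM; first exact: cvg_cst.
  by apply: cvgD; [exact: cvg_cst|exact: mulrr_continuous].
apply: continuous_comp_initial => x.
exact: continuous_comp (@trunc_seq_continuous n x) (c _).
Qed.

Definition code_set x : set (I01 R) := zero_I01 |` range (code_pt x).

Lemma nbhs_zero_I01 (U : set (I01 R)) : open U -> U zero_I01 ->
  exists N, forall t : I01 R, set_val t < 2 ^- N -> U t.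
Proof.
move=> [V Vo <-] V0.
have /nbhs_ballP[e /= e0 eV] : nbhs (0 : R) V by exact: open_nbhs_nbhs.
have [N Ne] := exp2N_lt_ex e0; exists N => t tN; apply: eV.
have /andP[t0 _] : 0 <= set_val t <= 1 by have := I01_itv t; rewrite in_itv.
by rewrite /ball/= sub0r normrN ger0_norm// (lt_trans tN).
Qed.

Lemma code_set_closed x : closed (code_set x).
Proof.
(* Each [A N] is a closed half-line with finitely many points added. In [[0, 1]] their intersection
   is the code, because a positive [t] exceeds some [2 ^- N]. *)
pose A N : set R :=
  [set t | t <= 2 ^- N] `|` \bigcup_(n in `I_N) [set dyadic_pt (trunc_seq x) n].
have -> : code_set x = set_val @^-1` (\bigcap_N A N).
  apply/seteqP; split => [_ [->|[n _ <-]] N _ /=|t At].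
  - by left; rewrite /= zero_I01E ltW// exp2N_gt0.
  - have [nN|Nn] := ltnP n N.
      by right; exists n.
    left; rewrite /= code_ptE.
    have /andP[_ ub] := dyadic_pt_itv (trunc_seq_itv x n).
    by rewrite ltW// (lt_le_trans ub)// exp2N_le.
  - have [t0|t0] := eqVneq (set_val t) 0; first by left; apply: val_inj.
    have [N Nt] : exists N, 2 ^- N < set_val t.
      apply: exp2N_lt_ex; rewrite lt_neqAle eq_sym t0.
      by have := I01_itv t; rewrite in_itv => /andP[].
    have [] := At N I; first by rewrite /= leNgt Nt.
    move=> [n _ /= tn]; right; exists n => //.
    exact: val_inj.
apply: closed_comp => [t _|]; first exact: set_val_I01_continuous.
apply: closed_bigI => N _; apply: closedU; first exact: closed_le.
by rewrite bigcup_mkord; apply: closed_bigsetU => n _; exact: closed_eq.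
Qed.

(** The map is continuous. Meeting [U] is witnessed by 0 or by one continuously moving point; for
    inclusion in [U], the uniform bound [2 ^- n] puts all points of large index in [U], which leaves
    finitely many open conditions. *)
Lemma borel_map_null_sequence (X : topologicalType) (P : nat -> X -> I01 R)
    (F : X -> hyperspace (I01 R)) :
  (forall n, continuous (P n)) -> (forall n (z : X), set_val (P n z) < 2 ^- n :> R) ->
  (forall z : X, set_val (F z) = zero_I01 |` range (P ^~ z)) -> borel_map F.
Proof.
move=> Pc Plt FE.
apply: borel_map_continuous; apply: hyperspace_open_preimage => U Uo.
- rewrite openE => x [t []]; rewrite FE => -[->|[n _ <-]] Ut.
    by apply: nearW => y; exists zero_I01; rewrite FE; split=> //; left.
  have near_U : \forall y \near x, U (P n y).
    by apply: (Pc n x); apply: open_nbhs_nbhs.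
  by apply: filterS near_U => y Uy; exists (P n y); rewrite FE; split => //; right;
    exists n.
- rewrite openE => x; rewrite /= FE => xU; have U0 : U zero_I01 by apply: xU; left.
  have [N HN] := nbhs_zero_I01 Uo U0.
  have near_U : \forall y \near x, forall n : 'I_N, U (P n y).
    apply: filter_forall => n; apply: (Pc n x).
    by apply: open_nbhs_nbhs; split => //; apply: xU; right; exists n.
  apply: filterS near_U => y Uy; rewrite /= FE => _ [->//|[n _ <-]].
  have [nN|Nn] := ltnP n N; first exact: (Uy (Ordinal nN)).
  by apply: HN; rewrite (lt_le_trans (Plt _ _))// exp2N_le.
Qed.

Definition code x : hyperspace (I01 R) :=
  exist (fun A => A \in [set A : set (I01 R) | closed A]) (code_set x)
    (mem_set (@code_set_closed x)).

Lemma codeE x : set_val (code x) = code_set x. Proof. by []. Qed.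

Lemma code_borel : borel_map code.
Proof.
apply: (@borel_map_null_sequence _ (fun n x => code_pt x n)) => // [|n x].
  exact: code_pt_continuous.
by have /andP[_] := dyadic_pt_itv (trunc_seq_itv x n).
Qed.

(** * The two implications of the reduction *)

Lemma c0_times_EH x y : c0_times x y -> EH_Diff01 (code x) (code y).
Proof.
move=> xy; have xy0 := cvg_dyadic_trunc (@real_seq_gt0 x) (@real_seq_gt0 y) xy.
have yx0 : trunc_seq y n - trunc_seq x n @[n --> \oo] --> (0 : R).
  by rewrite -oppr0; under eq_fun do rewrite -opprB; exact: cvgN.
have [f fD [f0 fP]] := dyadic_pt_Diff01 (trunc_seq_itv x) (trunc_seq_itv y) yx0.
have fz : f zero_I01 = zero_I01 by apply: val_inj; exact: f0.
have fx n : f (code_pt x n) = code_pt y n by apply: val_inj; exact: fP.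
exists f => //; rewrite !codeE /code_set image_setU image_set1 fz image_comp.
by rewrite (_ : f \o code_pt x = code_pt y)//; apply/funext.
Qed.

(** The minimum 0 is fixed, so [f] permutes the remaining points. Both codes decrease in the index,
    so the induced map of indices is increasing and onto, hence the identity. *)
Lemma code_rigid f g x y : increasing_homeo f g -> f @` code_set x = code_set y ->
  f zero_I01 = zero_I01 /\ forall n, f (code_pt x n) = code_pt y n.
Proof.
move=> [fi fK gK _ _] fxy.
have z_min (t : I01 R) : t != zero_I01 -> set_val zero_I01 < set_val t :> R.
  move=> tz; have := I01_itv t; rewrite in_itv/= => /andP[t0 _].
  by rewrite lt_neqAle t0 andbT eq_sym; apply: contra_neq tz => t0'; exact: val_inj.
have fz : f zero_I01 = zero_I01.
  apply: contrapT => /eqP /z_min fz; have [g0|/eqP gz] := pselect (g zero_I01 = zero_I01).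
    by move: fz; rewrite -[in f _]g0 gK ltxx.
  by have := fi _ _ (z_min _ gz); rewrite gK => /(lt_trans fz); rewrite ltxx.
split=> //.
have /choice[s sE] n : exists m, f (code_pt x n) = code_pt y m.
  have : code_set y (f (code_pt x n)).
    by rewrite -fxy; exists (code_pt x n) => //; right; exists n.
  case=> [fn|[m _ <-]]; last by exists m.
  have := code_pt_gt0 x n; rewrite (can_inj fK (etrans fn (esym fz))).
  by rewrite zero_I01E ltxx.
have si : {homo s : m n / (m < n)%N}.
  move=> m n mn; have := fi _ _ (code_pt_decr x mn); rewrite !sE ltNge => nle.
  rewrite ltnNge; apply: contra nle; rewrite leq_eqVlt => /predU1P[->//|].
  by move/(code_pt_decr y)/ltW.
have ss n : exists m, s m = n.
  have : (f @` code_set x) (code_pt y n) by rewrite fxy; right; exists n.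
  case=> _ [->|[m _ <-]]; rewrite ?fz ?sE => ny.
    by have := code_pt_gt0 y n; rewrite -ny ltxx.
  exists m; have inj p q : (p < q)%N -> code_pt y p <> code_pt y q.
    by move=> pq e; have := code_pt_decr y pq; rewrite e ltxx.
  by case: (ltngtP (s m) n) => // /inj; rewrite ny.
by move=> n; rewrite sE (increasing_surj_nat_id si ss).
Qed.

Lemma EH_c0_times x y : EH_Diff01 (code x) (code y) -> c0_times x y.
Proof.
case=> f [g [fg [f' [fd _]] _]]; rewrite !codeE => /(code_rigid fg)[fz fP].
pose r n : R := (3 / 2 + trunc_seq y n / 32) / (3 / 2 + trunc_seq x n / 32).
have rE n : r n = set_val (code_pt y n) / set_val (code_pt x n).
  by rewrite !code_ptE -mulf_div divff ?mul1r// gt_eqF// exp2N_gt0.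
(* As [f] fixes 0, [r n] is its difference quotient at 0 taken at [code_pt x n], which tends to
   0. *)
have rl : r n @[n --> \oo] --> f' zero_I01.
  apply/cvgrPdist_le => /= e e0; have /= := cvgr_dist_le _ _ (fd zero_I01) _ e0.
  rewrite near_withinE nbhsE => -[U [Uo U0] HU].
  have [N HN] := nbhs_zero_I01 Uo U0; exists N => // n /= Nn.
  have /andP[_ ub] := dyadic_pt_itv (trunc_seq_itv x n).
  have := HU (code_pt x n); rewrite fz fP zero_I01E !subr0 -rE; apply.
    by apply: HN; rewrite (lt_le_trans ub)// exp2N_le.
  by apply/eqP => xz; have := code_pt_gt0 x n; rewrite xz ltxx.
(* [r n] equals 1 for arbitrarily large [n], so its limit cannot differ from 1. *)
have l1 : f' zero_I01 = 1.
  apply/eqP; rewrite -subr_eq0 -normr_eq0; apply/negPn/negP => l1.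
  have l0 : 0 < `|f' zero_I01 - 1| / 2.
    by rewrite divr_gt0// lt_neqAle eq_sym l1 normr_ge0.
  have [N _ HN] := cvgr_dist_le _ _ rl _ l0.
  have [n Nn uv] := frequently_dyadic_trunc_eq N (@real_seq_gt0 x) (@real_seq_gt0 y).
  have := HN n Nn; rewrite /r /trunc_seq uv divff; first by lra.
  by have /andP[] := trunc_seq_itv y n; rewrite /trunc_seq => ? _; rewrite gt_eqF//; lra.
apply: (dyadic_trunc_cvg (real_seq_itv x) (real_seq_itv y)).
rewrite l1 in rl; apply/cvgrPdist_le => /= e e0.
(* [1 - r n] is [(u - v) / (48 + u)] with [48 + u <= 49 < 64]. *)
have e64 : 0 < e / 64 by rewrite divr_gt0.
apply: filterS (cvgr_dist_le _ _ rl _ e64) => n; rewrite sub0r normrN.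
have /andP[u0 u1] := trunc_seq_itv x n; rewrite -/(trunc_seq x) -/(trunc_seq y) /r.
move: (trunc_seq x n) (trunc_seq y n) u0 u1 => u v u0 u1.
have -> : 1 - (3 / 2 + v / 32) / (3 / 2 + u / 32) = (u - v) / (48 + u).
  by field; apply/andP; split; rewrite gt_eqF//; lra.
rewrite normrM normfV ler_pdivrMr ?normr_gt0 ?gt_eqF//; last by lra.
rewrite (@gtr0_norm _ (48 + u)); last by lra.
by move=> h; apply: le_trans h _; nra.
Qed.
End Reduction.

Theorem theorem3p17 (R : realType) :
  borel_reducible (@c0_times R) (@EH_Diff01 R).
Proof.
exists (@code R); split; first exact: code_borel.
by move=> x y; split; [exact: c0_times_EH|exact: EH_c0_times].
Qed.
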